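(* Let $\mathcal F=(F_1\subset F_2\subset\cdots)$ be a tower over $\mathbb F_\ell$ such that $F_1=\mathbb F_\ell(x_1)$ is a rational function field and, for all $i>1$, $F_i=F_{i-1}(x_i)$ where $$\sum_{j=0}^{n-k-1}\frac{x_i^{q^j}}{x_{i-1}^{q^{k+j}}}+\sum_{j=0}^{k-1}\frac{x_i^{q^{n-k+j}}}{x_{i-1}^{q^{j}}}=1.$$ Then there exists a finite extension $E/F_1$ such that each step $EF_{i+1}/EF_i$ ($i\ge1$) in the composite tower $E\mathcal F=(EF_1\subset EF_2\subset\cdots)$ is Galois with an elementary abelian $p$-group as Galois group.
   Context: $q$ is a power of a prime $p$, $n\ge2$ and $1\le k<n$ are integers with $\gcd(k,n-k)=1$, and $\ell=q^n$. A tower over $\mathbb F_\ell$ is a sequence $G_1\subset G_2\subset\cdots$ of function fields with full constant field $\mathbb F_\ell$. Composites are taken in a fixed algebraic closure of $\bigcup_i F_i$. *)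

(* Defs.v *)
From HB Require Import structures.
From mathcomp Require Import all_boot all_order all_algebra.
From mathcomp Require Import all_fingroup all_solvable all_field.
From mathcomp Require Import boolp classical_sets.

Set Implicit Arguments.
Unset Strict Implicit.
Unset Printing Implicit Defensive.

Import GRing.Theory.
Local Open Scope classical_set_scope.
Local Open Scope ring_scope.

(* All fields are subfields of one ambient field Om, represented as sets; the  *)
(* constant field Fl is a type of its own, embedded in Om by iota.             *)

Definition subfield (Om : fieldType) (K : set Om) : Prop :=
  GRing.divring_closed (mem K).

Definition gen_field (Om : fieldType) (S : set Om) : set Om :=
  smallest (@subfield Om) S.

Definition adjoin (Om : fieldType) (K : set Om) (x : Om) : set Om :=
  gen_field (K `|` [set x]).

Definition composite (Om : fieldType) (K L : set Om) : set Om :=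
  gen_field (K `|` L).

(* For subfields K and L: K is contained in L and L is finite-dimensional      *)
(* over K.                                                                     *)
Definition finite_ext (Om : fieldType) (K L : set Om) : Prop :=
  K `<=` L /\
  exists (m : nat) (e : 'I_m -> Om),
    L = [set z | exists2 a : 'I_m -> Om,
                   forall i, K (a i) & z = \sum_(i < m) a i * e i].

Definition algebraic_over (Om : fieldType) (K : set Om) (z : Om) : Prop :=
  exists p : {poly Om}, [/\ p != 0, forall j, K p`_j & root p z].

Definition function_field (Fl Om : fieldType) (iota : {rmorphism Fl -> Om})
    (G : set Om) : Prop :=
  subfield G /\
  exists2 t : Om, ~ algebraicOver iota t & finite_ext (adjoin (range iota) t) G.

Definition full_constant_field (Fl Om : fieldType)
    (iota : {rmorphism Fl -> Om}) (G : set Om) : Prop :=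
  forall z, G z -> algebraicOver iota z -> range iota z.

(* G i stands for the (i+1)-st field of the tower.                             *)
Definition tower (Fl Om : fieldType) (iota : {rmorphism Fl -> Om})
    (G : nat -> set Om) : Prop :=
  (forall i, function_field iota (G i) /\ full_constant_field iota (G i)) /\
  (forall i, G i `<=` G i.+1).

(* The extension of subfields L / K of Om is finite Galois with elementary     *)
(* abelian p-group as Galois group. Galois theory in the library lives on      *)
(* extension types L0 over a base field type K0, so L / K is transported along *)
(* an embedding f of L0 in Om with f(L0) = L and f(K0) = K; every finite       *)
(* Galois extension L / K arises in this way.                                  *)
Definition galois_abelem (p : nat) (Om : fieldType) (K L : set Om) : Prop :=
  exists (K0 : fieldType) (L0 : splittingFieldType K0)
         (f : {rmorphism L0 -> Om}),
    [/\ range (fun a : K0 => f a%:A) = K,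
        range f = L,
        galois 1%VS {:L0}%VS &
        (p.-abelem 'Gal({:L0}%VS / 1%VS))%g].

(* Main.v *)
Require Import Defs.
From HB Require Import structures.
From mathcomp Require Import all_boot all_order all_algebra.
From mathcomp Require Import all_fingroup all_solvable all_field.
From mathcomp Require Import boolp classical_sets.
From mathcomp Require Import ring.

Set Implicit Arguments.
Unset Strict Implicit.
Unset Printing Implicit Defensive.

Import GRing.Theory.
Local Open Scope classical_set_scope.
Local Open Scope ring_scope.

(* Write tau for the q-th power map, Tr_m = 1 + tau + ... + tau^(m-1), d = n - k *)
(* and P_X(Y) = Tr_d(Y / X^(q^k)) + Tr_k(Y^(q^d) / X), so that the tower is      *)
(* given by P_(x_i)(x_(i+1)) = 1. As P_X is additive and separable in Y, the     *)
(* step EF_(i+1) / EF_i is Galois with translations as automorphisms as soon as  *)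
(* V_i = ker P_(x_i) lies in EF_i. Take E = F_1(V_1); it remains to pass from    *)
(* V_i to V_(i+1). Put X = x_i and Y = x_(i+1). Since                            *)
(*   X^(q^k) (tau - 1) P_X = tau^n - c tau^d - 1,                                *)
(*   c = (X^(q^n) - X) X^(q^k) / (X^(q^n) X) = (Y^(q^n) - Y) / Y^(q^d),          *)
(* the kernel W of this operator is V_i + F_q Y, hence lies in EF_(i+1), and the *)
(* isogeny tau^k - Y^(q^k - 1), which is defined over EF_(i+1), maps W onto      *)
(* V_(i+1); surjectivity is additive Hilbert 90 and uses gcd(k, n) = 1.          *)

Definition subfield_pred (Om : fieldType) (K : set Om) of subfield K : {pred Om} :=
  mem K.
HB.instance Definition _ (Om : fieldType) (K : set Om) (hK : subfield K) :=
  GRing.isDivringClosed.Build Om (subfield_pred hK) hK.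

Definition subfield_type (Om : fieldType) (K : set Om) (hK : subfield K) :=
  {z : Om | z \in subfield_pred hK}.
HB.instance Definition _ (Om : fieldType) (K : set Om) (hK : subfield K) :=
  SubChoice.on (subfield_type hK).
HB.instance Definition _ (Om : fieldType) (K : set Om) (hK : subfield K) :=
  [SubChoice_isSubIntegralDomain of subfield_type hK by <:].
HB.instance Definition _ (Om : fieldType) (K : set Om) (hK : subfield K) :=
  [SubIntegralDomain_isSubField of subfield_type hK by <:].

Section Subfields.
Variable Om : fieldType.
Implicit Types (K L M S : set Om) (z : Om).

Lemma subfieldP K : subfield K <->
  [/\ K 1, forall a b, K a -> K b -> K (a - b)
         & forall a b, K a -> K b -> K (a / b)].
Proof.
split=> [[K1 KB Kdiv] | [K1 KB Kdiv]].
  split=> [|a b Ka Kb|a b Ka Kb]; first by rewrite -in_setE.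
    by rewrite -in_setE; apply: KB; rewrite in_setE.
  by rewrite -in_setE; apply: Kdiv; rewrite in_setE.
split=> [|a b|a b]; rewrite ?in_setE //; first exact: KB.
exact: Kdiv.
Qed.

Lemma subfield_valP K (hK : subfield K) (a : subfield_type hK) : K (val a).
Proof. by rewrite -in_setE; exact: (valP a). Qed.

Lemma range_subfield_val K (hK : subfield K) :
  range (val : subfield_type hK -> Om) = K.
Proof.
apply/seteqP; split=> [_ [a _ <-]|z]; first exact: subfield_valP.
by rewrite -in_setE => Kz; exists (Sub z Kz); rewrite ?SubK.
Qed.

Lemma subfield_gen S : subfield (gen_field S).
Proof.
apply/subfieldP; split=> [K|a b Sa Sb K|a b Sa Sb K] [hK sSK];
  have [K1 KB Kdiv] := (subfieldP K).1 hK; rewrite //.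
  by apply: KB; [apply: Sa|apply: Sb].
by apply: Kdiv; [apply: Sa|apply: Sb].
Qed.

Lemma sub_gen_field S : S `<=` gen_field S.
Proof. exact: sub_smallest. Qed.

Lemma gen_field_sub K S : subfield K -> S `<=` K -> gen_field S `<=` K.
Proof. by move=> hK sSK z; apply. Qed.

Lemma sub_adjoin K z : K `<=` adjoin K z.
Proof. by move=> a Ka; apply: sub_gen_field; left. Qed.

Lemma mem_adjoin K z : adjoin K z z.
Proof. by apply: sub_gen_field; right. Qed.

Lemma adjoin_sub K L z : subfield L -> K `<=` L -> L z -> adjoin K z `<=` L.
Proof. by move=> hL sKL Lz; apply: gen_field_sub => // a [/sKL|->]. Qed.

Lemma subfield_adjoin K z : subfield (adjoin K z).
Proof. exact: subfield_gen. Qed.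

Lemma composite_subl K L : K `<=` composite K L.
Proof. by move=> a Ka; apply: sub_gen_field; left. Qed.

Lemma composite_subr K L : L `<=` composite K L.
Proof. by move=> a La; apply: sub_gen_field; right. Qed.

Lemma composite_adjoin K L z :
  composite K (adjoin L z) = adjoin (composite K L) z.
Proof.
apply/seteqP; split.
  apply: gen_field_sub; first exact: subfield_gen.
  move=> a [Ka|]; first by apply: sub_adjoin; apply: composite_subl.
  apply: adjoin_sub; [exact: subfield_gen| |exact: mem_adjoin].
  by move=> b Lb; apply: sub_adjoin; apply: composite_subr.
apply: adjoin_sub; first exact: subfield_gen.
  apply: gen_field_sub; first exact: subfield_gen.
  move=> a [Ka|La]; first exact: composite_subl.
  by apply: composite_subr; apply: sub_adjoin.
by apply: composite_subr; apply: mem_adjoin.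
Qed.

Lemma lift_poly K (hK : subfield K) (p : {poly Om}) :
    (forall i, K p`_i) ->
  exists p0 : {poly subfield_type hK}, map_poly val p0 = p.
Proof.
move=> Kp; have mem_p i : p`_i \in subfield_pred hK by rewrite in_setE.
exists (\poly_(i < size p) Sub p`_i (mem_p i)).
apply/polyP=> i; rewrite coef_map coef_poly.
by case: ltnP => [_|/(nth_default 0)->]; rewrite ?SubK ?rmorph0.
Qed.

Lemma subfield_range (F0 : fieldType) (f : {rmorphism F0 -> Om}) :
  subfield (range f).
Proof.
apply/subfieldP; split=> [|_ _ [a _ <-] [b _ <-]|_ _ [a _ <-] [b _ <-]].
- by exists 1; rewrite ?rmorph1.
- by exists (a - b); rewrite ?rmorphB.
by exists (a / b); rewrite ?fmorph_div.
Qed.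

Lemma simple_extension K (hK : subfield K) z : algebraic_over K z ->
  exists (L0 : fieldExtType (subfield_type hK)) (f : {rmorphism L0 -> Om})
         (z0 : L0),
    [/\ forall a, f a%:A = val a, f z0 = z & <<1; z0>>%VS = fullv].
Proof.
case=> p [nz_p Kp pz0]; have [p0 Dp] := lift_poly hK Kp.
pose P d := `[< exists q : {poly subfield_type hK},
    [/\ q != 0, root (map_poly val q) z & size q = d] >].
have exP : exists d, P d.
  exists (size p0); apply/asboolP; exists p0; split=> //; last by rewrite Dp.
  by apply: contraNneq nz_p => p00; rewrite -Dp p00 rmorph0.
case: (ex_minnP exP) => _ /asboolP[q [nz_q qz0 <-]] min_q.
have irr_q : irreducible_poly q.
  apply/(subfx_irreducibleP qz0 nz_q) => r rz0 nz_r.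
  by apply: min_q; apply/asboolP; exists r.
exists (SubFieldExtType qz0 irr_q), (@subfx_inj _ _ val z q),
  (subfx_root val z q); split.
- exact: subfx_inj_base.
- exact: subfx_inj_root.
apply/vspaceP=> v; rewrite memvf; apply/Fadjoin_polyP.
have [r ->] := subfxEroot qz0 nz_q v.
exists (map_poly (in_alg (SubFieldExtType qz0 irr_q)) r) => //.
by apply/polyOverP=> i; rewrite coef_map memvZ ?mem1v.
Qed.

Section FieldExtRange.
Variables (F0 : fieldType) (L0 : fieldExtType F0) (f : {rmorphism L0 -> Om}).
Let K := range (fun a : F0 => f a%:A).

Lemma finite_ext_range : finite_ext K (range f).
Proof.
split=> [_ [a _ <-]|]; first by exists a%:A.
exists (\dim {:L0}), (fun i => f (vbasis {:L0})`_i); apply/seteqP; split.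
  move=> _ [v _ <-]; exists (fun i => f (coord (vbasis {:L0}) i v)%:A).
    by move=> i; exists (coord (vbasis {:L0}) i v).
  rewrite {1}(coord_vbasis (memvf v)) rmorph_sum; apply: eq_bigr => i _.
  by rewrite -rmorphM /= mulr_algl.
move=> _ [a Ka ->].
have [b Db] : exists b : 'I_(\dim {:L0}) -> F0, forall i, a i = f (b i)%:A.
  have /choice[b Db] : forall i, exists c : F0, a i = f c%:A.
    by move=> i; have [c _ <-] := Ka i; exists c.
  by exists b.
exists (\sum_i (b i)%:A * (vbasis {:L0})`_i) => //.
by rewrite rmorph_sum; apply: eq_bigr => i _; rewrite rmorphM /= Db.
Qed.

Lemma adjoin_range (z0 : L0) : <<1; z0>>%VS = {:L0}%VS -> range f = adjoin K (f z0).
Proof.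
move=> gen_z0; apply/seteqP; split.
  move=> _ [v _ <-]; have: v \in <<1; z0>>%VS by rewrite gen_z0 memvf.
  case/Fadjoin_polyP=> p Kp ->.
  rewrite -horner_map horner_coef.
  have adjP : forall u, u \in subfield_pred (subfield_adjoin K (f z0)) ->
    adjoin K (f z0) u by move=> u; rewrite in_setE.
  apply: adjP; apply: rpred_sum => i _; apply: rpredM.
    rewrite in_setE coef_map; apply: sub_adjoin.
    have /vlineP[c ->] := polyOverP Kp i.
    by exists c.
  by apply: rpredX; rewrite in_setE; apply: mem_adjoin.
apply: adjoin_sub; [exact: subfield_range| |by exists z0].
by move=> _ [a _ <-]; exists a%:A.
Qed.

End FieldExtRange.

Lemma finite_ext_refl K : subfield K -> finite_ext K K.
Proof.
case/subfieldP=> K1 KB Kdiv; split=> //; exists 1%N, (fun=> 1).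
apply/seteqP; split=> [a Ka|_ [a Ka ->]].
  by exists (fun=> a) => //; rewrite big_ord1 mulr1.
by rewrite big_ord1 mulr1.
Qed.

Lemma finite_ext_trans K L M :
  subfield L -> finite_ext K L -> finite_ext L M -> finite_ext K M.
Proof.
move=> hL [sKL [m [u DL]]] [sLM [r [v DM]]]; split.
  by move=> a /sKL /sLM.
pose w (i : 'I_#|{: 'I_m * 'I_r}|) :=
  let ij := enum_val i in u ij.1 * v ij.2.
exists #|{: 'I_m * 'I_r}|, w.
have rew (c : 'I_m * 'I_r -> Om) :
    \sum_i c (enum_val i) * w i = \sum_j (\sum_i c (i, j) * u i) * v j.
  under [RHS]eq_bigr do rewrite mulr_suml.
  rewrite exchange_big pair_bigA /=.
  rewrite -(big_enum_val (fun ij => c ij * (u ij.1 * v ij.2))).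
  by apply: eq_bigr => -[i j] _; rewrite mulrA.
rewrite DM; apply/seteqP; split=> [_ [b Lb ->]|_ [a Ka ->]].
  have /choice[c Dc] : forall j, exists c : 'I_m -> Om,
      (forall i, K (c i)) /\ b j = \sum_i c i * u i.
    by move=> j; have := Lb j; rewrite DL => -[c Kc ->]; exists c.
  exists (fun i => c (enum_val i).2 (enum_val i).1).
    by move=> i; apply: (Dc _).1.
  rewrite (rew (fun ij => c ij.2 ij.1)).
  by apply: eq_bigr => j _; rewrite (Dc j).2.
exists (fun j => \sum_i a (enum_rank (i, j)) * u i).
  by move=> j; rewrite DL; exists (fun i => a (enum_rank (i, j))).
rewrite -(rew (fun ij => a (enum_rank ij))).
by apply: eq_bigr => i _; rewrite enum_valK.
Qed.

Lemma finite_ext_adjoin K z :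
  subfield K -> algebraic_over K z -> finite_ext K (adjoin K z).
Proof.
move=> hK /(simple_extension hK)[L0 [f [z0 [fA <- gen_z0]]]].
have DK : range (fun a : subfield_type hK => f a%:A) = K.
  by rewrite (funext fA); exact: range_subfield_val.
by have := finite_ext_range f; rewrite (adjoin_range f gen_z0) DK.
Qed.

Lemma algebraic_overW K L z : K `<=` L -> algebraic_over K z -> algebraic_over L z.
Proof. by move=> sKL [p [nz_p Kp pz0]]; exists p; split=> // j; apply: sKL. Qed.

Lemma finite_ext_adjoin_seq K (s : seq Om) :
    subfield K -> (forall z, z \in s -> algebraic_over K z) ->
  exists E, [/\ subfield E, finite_ext K E & forall z, z \in s -> E z].
Proof.
move=> hK; elim: s => [|z s IHs] alg_s.
  by exists K; split=> //; apply: finite_ext_refl.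
have [|E [hE finE sE]] := IHs.
  by move=> y sy; apply: alg_s; rewrite inE sy orbT.
exists (adjoin E z); split; first exact: subfield_adjoin.
  apply: (finite_ext_trans hE finE); apply: finite_ext_adjoin => //.
  by apply: algebraic_overW (alg_s z _); rewrite ?mem_head //; case: finE.
move=> y; rewrite inE => /predU1P[->|/sE Ey]; first exact: mem_adjoin.
exact: sub_adjoin.
Qed.

End Subfields.

Lemma abelem_gal_translations (p : nat) (K0 : fieldType)
    (L0 : splittingFieldType K0) (z0 : L0) :
    prime p -> p \in [pchar L0] -> <<1; z0>>%VS = {:L0}%VS ->
    (forall s : gal_of {:L0}, s \in 'Gal({:L0} / 1)%g ->
       s z0 - z0 \in 1%VS) ->
  (p.-abelem 'Gal({:L0}%VS / 1%VS))%g.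
Proof.
move=> hp pcharL gen_z0 transl.
have gal_inj (s t : gal_of {:L0}) : s \in 'Gal({:L0} / 1)%g ->
    t \in 'Gal({:L0} / 1)%g -> s z0 = t z0 -> s = t.
  move=> Gs Gt eq_st; apply/eqP/gal_eqP => v _.
  have /Fadjoin_polyP[q q1 ->] : v \in <<1; z0>>%VS by rewrite gen_z0 memvf.
  by rewrite -!horner_map !(fixedPoly_gal (sub1v _)) //= eq_st.
have galD (s t : gal_of {:L0}) : s \in 'Gal({:L0} / 1)%g ->
    t \in 'Gal({:L0} / 1)%g -> (s * t)%g z0 = z0 + (s z0 - z0) + (t z0 - z0).
  move=> Gs Gt; rewrite galM ?memvf //.
  rewrite -[s z0 in LHS](subrK z0) rmorphD /= (fixed_gal (sub1v _) Gt) ?transl //.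
  by rewrite [z0 + _]addrC subrK addrAC addrA.
rewrite abelemE //; apply/andP; split.
  apply/centsP => s Gs t Gt; apply: gal_inj; rewrite ?groupM //.
  by rewrite !galD // addrAC.
apply/exponentP => s Gs; apply: gal_inj; rewrite ?groupX ?group1 //.
have galX m : (s ^+ m)%g z0 = z0 + (s z0 - z0) *+ m.
  elim: m => [|m IHm]; first by rewrite expg0 gal_id addr0.
  rewrite expgSr galD ?groupX // [z0 + (_ - z0)]addrC subrK IHm mulrSr.
  exact/esym/addrA.
by rewrite galX mulrn_pchar // addr0 gal_id.
Qed.

Section NormalSimpleExtension.
Variables (Om : closedFieldType) (K : set Om) (hK : subfield K).
Variables (P0 : {poly subfield_type hK}) (x : Om).
Let P := map_poly (val : subfield_type hK -> Om) P0.
Hypotheses (nzP : P != 0) (Px0 : root P x).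
Hypothesis Kdiff : forall y, root P y -> K (y - x).

Lemma root_sub_in1 (L0 : fieldExtType (subfield_type hK))
    (f : {rmorphism L0 -> Om}) (z0 : L0) y :
    (forall a, f a%:A = val a) -> f z0 = x -> root P y ->
  exists2 u : L0, f u = y & u - z0 \in 1%VS.
Proof.
move=> fA fz0 /Kdiff Ky.
have [_ /(_ _ Ky) [c _ Dc]] := (seteqP _ _).1 (range_subfield_val hK).
exists (z0 + c%:A); first by rewrite rmorphD /= fA fz0 Dc addrC subrK.
by rewrite addrAC subrr add0r memvZ ?mem1v.
Qed.

Lemma normal_simple_extension :
  exists (L0 : splittingFieldType (subfield_type hK))
         (f : {rmorphism L0 -> Om}) (z0 : L0),
    [/\ forall a, f a%:A = val a, f z0 = x, <<1; z0>>%VS = {:L0}%VS &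
        splittingFieldFor 1 (map_poly (in_alg L0) P0) {:L0}].
Proof.
have KP i : K P`_i by rewrite coef_map; apply: subfield_valP.
have [L0 [f [z0 [fA fz0 gen_z0]]]] :=
  simple_extension hK (ex_intro _ P (And3 nzP KP Px0)).
pose PL := map_poly (in_alg L0) P0.
have DPL : map_poly f PL = P.
  by rewrite -map_poly_comp; apply: eq_map_poly => a /=; rewrite fA.
have nzPL : PL != 0 by rewrite -(map_poly_eq0 f) DPL.
have PL1 : PL \is a polyOver 1%VS.
  by apply/polyOverP=> i; rewrite coef_map memvZ ?mem1v.
have /choice[g Dg] : forall y, exists u : L0, root P y -> f u = y.
  move=> y; have [Py0|_] := boolP (root P y); last by exists 0.
  by have [u fu _] := root_sub_in1 fA fz0 Py0; exists u.
have [rs Drs] := closed_field_poly_normal P.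
have rootP y : (y \in rs) = root P y.
  by rewrite Drs rootZ ?lead_coef_eq0 // root_prod_XsubC.
have splitPL : splittingFieldFor 1 PL {:L0}.
  exists (map g rs).
    apply/eqpP; exists (1, lead_coef PL); first by rewrite oner_neq0 lead_coef_eq0.
    apply: (map_poly_inj f); rewrite scale1r DPL map_polyZ /= -lead_coef_map DPL.
    rewrite {1}Drs; congr (_ *: _).
    rewrite rmorph_prod big_map big_seq [RHS]big_seq.
    apply: eq_bigr => y; rewrite rootP => /Dg fgy.
    by rewrite rmorphB /= map_polyX map_polyC /= fgy.
  apply/eqP; rewrite eqEsubv subvf -gen_z0 /=.
  have Dz0 : z0 = g x by apply: (fmorph_inj f); rewrite fz0 Dg.
  apply/FadjoinP; rewrite subv_adjoin_seq; split=> //.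
  by rewrite seqv_sub_adjoin // Dz0 map_f ?rootP.
pose splitL := FieldExt_isSplittingField.Build _ L0 (ex_intro2 _ _ PL PL1 splitPL).
pose L1 : splittingFieldType (subfield_type hK) :=
  HB.pack (FieldExt.sort L0) splitL.
by exists L1, f, z0.
Qed.

Lemma galois_abelem_adjoin_lift p :
    prime p -> p \in [pchar Om] -> separable_poly P ->
  galois_abelem p K (adjoin K x).
Proof.
move=> hp pcharOm sepP.
have [L0 [f [z0 [fA fz0 gen_z0 splitPL]]]] := normal_simple_extension.
set PL := map_poly (in_alg L0) P0 in splitPL.
have DPL : map_poly f PL = P.
  by rewrite -map_poly_comp; apply: eq_map_poly => a /=; rewrite fA.
have PL1 : PL \is a polyOver 1%VS.
  by apply/polyOverP=> i; rewrite coef_map memvZ ?mem1v.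
have DK : range (fun a : subfield_type hK => f a%:A) = K.
  by rewrite (funext fA); exact: range_subfield_val.
exists (subfield_type hK), L0, f; split=> //.
- by rewrite (adjoin_range f gen_z0) fz0 DK.
- apply/splitting_galoisField; exists PL; split=> //.
  by rewrite -(separable_map f) DPL.
have pcharL : p \in [pchar L0] by rewrite -(fmorph_pchar f).
apply: (abelem_gal_translations hp pcharL gen_z0) => s Gs.
have : root P (f (s z0)).
  rewrite -DPL fmorph_root -[PL](fixedPoly_gal (sub1v _) Gs PL1) fmorph_root.
  by rewrite -(fmorph_root f) DPL fz0.
by move/(root_sub_in1 fA fz0) => [u /(fmorph_inj f) ->].
Qed.

End NormalSimpleExtension.

Lemma galois_abelem_adjoin (p : nat) (Om : closedFieldType) (K : set Om)
    (P : {poly Om}) (x : Om) :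
    prime p -> p \in [pchar Om] -> subfield K -> (forall i, K P`_i) ->
    separable_poly P -> root P x -> (forall y, root P y -> K (y - x)) ->
  galois_abelem p K (adjoin K x).
Proof.
move=> hp pcharOm hK KP sepP Px0 Kdiff; have [P0 DP] := lift_poly hK KP.
by apply: (@galois_abelem_adjoin_lift _ _ hK P0); rewrite ?DP ?separable_poly_neq0.
Qed.

Definition frob_trace (R : pzRingType) (q m : nat) (z : R) : R :=
  \sum_(0 <= j < m) z ^+ (q ^ j).

Section FrobeniusTrace.
Variables (Om : fieldType) (q : nat).
Hypothesis hq : [pchar Om].-nat q.
Implicit Types z a b : Om.

Lemma pchar_nat_exp i : [pchar Om].-nat (q ^ i)%N.
Proof. by rewrite pnatX hq. Qed.

Lemma frobD i a b : (a + b) ^+ (q ^ i) = a ^+ (q ^ i) + b ^+ (q ^ i).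
Proof. exact/exprDn_pchar/pchar_nat_exp. Qed.

Lemma frobB i a b : (a - b) ^+ (q ^ i) = a ^+ (q ^ i) - b ^+ (q ^ i).
Proof. by apply/(canRL (addrK _)); rewrite -frobD subrK. Qed.

Lemma frob_comp i j z : (z ^+ (q ^ i)) ^+ (q ^ j) = z ^+ (q ^ (i + j)).
Proof. by rewrite -exprM -expnD. Qed.

Lemma frob0 i : (0 : Om) ^+ (q ^ i) = 0.
Proof. by have /andP[qi_gt0 _] := pchar_nat_exp i; rewrite expr0n gtn_eqF. Qed.

Lemma frob_sum i m (F : nat -> Om) :
  (\sum_(0 <= j < m) F j) ^+ (q ^ i) = \sum_(0 <= j < m) F j ^+ (q ^ i).
Proof. by apply: (big_morph _ (frobD i) (frob0 i)). Qed.

Lemma frob_fix i z : z ^+ q = z -> z ^+ (q ^ i) = z.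
Proof. by move=> zq; elim: i => // i IHi; rewrite expnS exprM zq. Qed.

Lemma frob_traceD m a b :
  frob_trace q m (a + b) = frob_trace q m a + frob_trace q m b.
Proof. by rewrite -big_split; apply: eq_bigr => j _; rewrite frobD. Qed.

Lemma frob_traceB m a b :
  frob_trace q m (a - b) = frob_trace q m a - frob_trace q m b.
Proof. by rewrite -sumrB; apply: eq_bigr => j _; rewrite frobB. Qed.

Lemma frob_traceZ m a b :
  a ^+ q = a -> frob_trace q m (a * b) = a * frob_trace q m b.
Proof.
move=> aq; rewrite mulr_sumr; apply: eq_bigr => j _.
by rewrite exprMn frob_fix.
Qed.

Lemma frob_trace_frob i m z :
  frob_trace q m z ^+ (q ^ i) = frob_trace q m (z ^+ (q ^ i)).
Proof. by rewrite frob_sum; apply: eq_bigr => j _; rewrite exprAC. Qed.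

Lemma frob_trace_add i m z :
  frob_trace q (i + m) z = frob_trace q i z + frob_trace q m (z ^+ (q ^ i)).
Proof.
rewrite /frob_trace (big_cat_nat _ (leq_addr m i)) //=; congr (_ + _).
by rewrite -{1}[i]add0n big_addn addKn; apply: eq_bigr => j _; rewrite frob_comp addnC.
Qed.

(* Both sides are [(tau^i - 1) (tau^m - 1) / (tau - 1)] applied to [z]. *)
Lemma frob_trace_comm i m z :
  frob_trace q m (z ^+ (q ^ i) - z) = frob_trace q i (z ^+ (q ^ m) - z).
Proof.
rewrite !frob_traceB; apply/eqP; rewrite subr_eq addrAC eq_sym subr_eq eq_sym.
by rewrite addrC -frob_trace_add addnC frob_trace_add addrC.
Qed.

Lemma frob_trace_telescope m z :
  frob_trace q m z ^+ q - frob_trace q m z = z ^+ (q ^ m) - z.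
Proof.
have -> : frob_trace q m z ^+ q = frob_trace q m (z ^+ (q ^ 1)).
  by rewrite -frob_trace_frob expn1.
rewrite -frob_traceB frob_trace_comm.
by rewrite /frob_trace big_nat1 expn0 expr1.
Qed.

End FrobeniusTrace.

(* In [Y], this is the left-hand side of the equation of the tower, with
   [n = k + d]. *)
Definition tower_op (Om : fieldType) (q k d : nat) (X Y : Om) : Om :=
  frob_trace q d (Y / X ^+ (q ^ k)) + frob_trace q k (Y ^+ (q ^ d) / X).

Section TowerOperator.
Variables (Om : fieldType) (q k d : nat).
Hypothesis hq : [pchar Om].-nat q.
Implicit Types X Y z w : Om.
Local Notation P := (tower_op q k d).
Local Notation n := (k + d)%N.

Lemma tower_opE X Y : P X Y =
  \sum_(0 <= j < d) Y ^+ (q ^ j) / X ^+ (q ^ (k + j))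
  + \sum_(0 <= j < k) Y ^+ (q ^ (d + j)) / X ^+ (q ^ j).
Proof.
by congr (_ + _); apply: eq_bigr => j _; rewrite expr_div_n frob_comp.
Qed.

Lemma tower_op0 Y : P 0 Y = 0.
Proof.
have tr0 m : frob_trace q m (0 : Om) = 0.
  by rewrite /frob_trace big1 // => j _; rewrite frob0.
by rewrite /tower_op frob0 // invr0 !mulr0 !tr0 addr0.
Qed.

Lemma tower_opB X a b : P X (a - b) = P X a - P X b.
Proof.
by rewrite /tower_op frobB // !mulrBl !frob_traceB // opprD addrACA.
Qed.

Lemma tower_opZ X a b : a ^+ q = a -> P X (a * b) = a * P X b.
Proof.
move=> aq; rewrite /tower_op exprMn (frob_fix _ aq) -!mulrA.
by rewrite (frob_traceZ _ (b / _) aq) (frob_traceZ _ (_ / X) aq) mulrDr.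
Qed.

Lemma tower_op_frob X z : X != 0 ->
  P X z ^+ q - P X z =
  (z ^+ (q ^ n)
   - (X ^+ (q ^ n) - X) * X ^+ (q ^ k) / (X ^+ (q ^ n) * X) * z ^+ (q ^ d)
   - z) / X ^+ (q ^ k).
Proof.
move=> nzX; rewrite /tower_op (exprDn_pchar _ _ hq).
rewrite opprD addrACA !frob_trace_telescope // !expr_div_n !frob_comp.
rewrite [(d + k)%N]addnC.
have nzX' i : X ^+ i != 0 by rewrite expf_neq0.
have := nzX' (q ^ n)%N; have := nzX' (q ^ k)%N.
move: (X ^+ (q ^ n)) (X ^+ (q ^ k)) (z ^+ (q ^ n)) (z ^+ (q ^ d)) => Xn Xk zn zd.
by move=> nzXk nzXn; field; rewrite nzX nzXk nzXn.
Qed.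

(* [Y ^+ (q ^ k) / Y] stands for [Y^(q^k - 1)], without truncated subtraction. *)
Lemma tower_op_isogeny Y w : Y != 0 ->
  P Y (w ^+ (q ^ k) - Y ^+ (q ^ k) / Y * w) =
  frob_trace q k ((w ^+ (q ^ n)
    - (Y ^+ (q ^ n) - Y) / Y ^+ (q ^ d) * w ^+ (q ^ d) - w) / Y).
Proof.
move=> nzY; have nzY' i : Y ^+ i != 0 by rewrite expf_neq0.
have -> : P Y (w ^+ (q ^ k) - Y ^+ (q ^ k) / Y * w) =
    frob_trace q d ((w / Y) ^+ (q ^ k) - w / Y) +
    frob_trace q k ((w ^+ (q ^ k) - Y ^+ (q ^ k) / Y * w) ^+ (q ^ d) / Y).
  congr (frob_trace q d _ + _); rewrite expr_div_n.
  by field; rewrite nzY nzY'.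
rewrite frob_trace_comm // -frob_traceD //; congr (frob_trace q k _).
rewrite frobB // !exprMn !exprVn !frob_comp.
have := nzY' (q ^ n)%N; have := nzY' (q ^ d)%N.
move: (Y ^+ (q ^ n)) (Y ^+ (q ^ d)) (w ^+ (q ^ n)) (w ^+ (q ^ d)) => Yn Yd wn wd.
by move=> nzYd nzYn; field; rewrite nzY nzYd.
Qed.

End TowerOperator.

Lemma solve_frob (Om : closedFieldType) (N : nat) (u z : Om) :
  (1 < N)%N -> exists w : Om, w ^+ N = u * w + z.
Proof.
case: N => [|[|N]] // _.
have [w Dw] := @solve_monicpoly Om N.+2 (nth 0 [:: z; u]) isT.
exists w; rewrite Dw !big_ord_recl /= big1 => [|i _]; last by rewrite nth_nil mul0r.
by rewrite expr0 mulr1 expr1 addr0 addrC.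
Qed.

(* Additive Hilbert 90 for the generator [tau^n] of the Galois group of the
   field of [q^k] elements. *)
Lemma hilbert90_frob (Om : closedFieldType) (q k n : nat) (b : Om) :
    [pchar Om].-nat q -> (1 < q)%N -> (0 < k)%N -> (0 < n)%N -> coprime n k ->
    frob_trace q k b = 0 ->
  exists2 a : Om, a ^+ (q ^ k) = a & a ^+ (q ^ n) = a - b.
Proof.
move=> hq q_gt1 k_gt0 n_gt0 co_nk trb0.
have [c Dc] := solve_frob 1 (- b) q_gt1; rewrite mul1r in Dc.
have ck : c ^+ (q ^ k) = c.
  have := frob_trace_comm hq 1 k c; rewrite expn1 Dc addrAC subrr add0r.
  rewrite [RHS]big_nat1 expn0 expr1 -[- b]sub0r frob_traceB // trb0 subr0.
  by rewrite /frob_trace big1 => [/esym/eqP|j _]; rewrite ?subr_eq0 ?frob0 // => /eqP.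
have crk r : c ^+ (q ^ (r * k)) = c.
  by elim: r => [|r IHr]; rewrite ?expn0 ?expr1 // mulSn -frob_comp ck.
case: (egcdnP k n_gt0) => m r; rewrite (eqP co_nk) => Dmr _.
have hqn : [pchar Om].-nat (q ^ n)%N by apply: pchar_nat_exp.
exists (frob_trace (q ^ n) m c).
  rewrite frob_sum //; apply: eq_bigr => j _.
  by rewrite -!exprM mulnC exprM ck.
have := frob_trace_telescope hqn m c.
rewrite -expnM mulnC Dmr -frob_comp crk expn1 Dc addrAC subrr add0r.
by move=> Da; rewrite -Da addrC subrK.
Qed.

Section TowerStep.
Variables (Om : closedFieldType) (q k d : nat).
Hypotheses (hq : [pchar Om].-nat q) (q_gt1 : (1 < q)%N).
Hypotheses (k_gt0 : (0 < k)%N) (co_kd : coprime k d).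
Implicit Types X Y z w : Om.
Local Notation P := (tower_op q k d).
Local Notation n := (k + d)%N.

Lemma tower_op_ker_preimage Y z : Y != 0 -> P Y z = 0 ->
  exists2 w : Om,
    w ^+ (q ^ n) - (Y ^+ (q ^ n) - Y) / Y ^+ (q ^ d) * w ^+ (q ^ d) - w = 0
    & z = w ^+ (q ^ k) - Y ^+ (q ^ k) / Y * w.
Proof.
move=> nzY Pz0.
have [w Dw] : exists w : Om, w ^+ (q ^ k) = Y ^+ (q ^ k) / Y * w + z.
  by apply: solve_frob; rewrite -{1}(expn0 q) ltn_exp2l.
have {}Dw : z = w ^+ (q ^ k) - Y ^+ (q ^ k) / Y * w by rewrite Dw addrC addKr.
set c := (Y ^+ (q ^ n) - Y) / Y ^+ (q ^ d).
pose b := (w ^+ (q ^ n) - c * w ^+ (q ^ d) - w) / Y.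
have trb0 : frob_trace q k b = 0 by rewrite -tower_op_isogeny // -Dw.
have [||a ak an] := hilbert90_frob hq q_gt1 k_gt0 _ _ trb0 (n := n).
- by rewrite addn_gt0 k_gt0.
- by rewrite /coprime gcdnC gcdnDl.
have ad : a ^+ (q ^ d) = a - b by rewrite -an -frob_comp ak.
have nzY' i : Y ^+ i != 0 by rewrite expf_neq0.
exists (w + a * Y).
  have Db : w ^+ (q ^ n) = b * Y + c * w ^+ (q ^ d) + w.
    by rewrite /b divfK //; ring.
  rewrite !frobD // !exprMn Db an ad /c.
  by field; rewrite nzY'.
rewrite Dw frobD // exprMn ak.
by field.
Qed.

Lemma tower_op_ker_step (L : set Om) X Y : subfield L ->
    (forall a, a ^+ q = a -> L a) -> X != 0 -> Y != 0 -> L Y -> P X Y = 1 ->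
    (forall z, P X z = 0 -> L z) ->
  forall z, P Y z = 0 -> L z.
Proof.
move=> hL LFq nzX nzY LY PXY LV z Pz0.
have [w Dw ->] := tower_op_ker_preimage nzY Pz0.
have Lpred u : L u -> u \in subfield_pred hL by move=> Lu; rewrite in_setE.
have Lval u : u \in subfield_pred hL -> L u by rewrite in_setE.
have nzX' i : X ^+ i != 0 by rewrite expf_neq0.
have nzY' i : Y ^+ i != 0 by rewrite expf_neq0.
have Dc : (X ^+ (q ^ n) - X) * X ^+ (q ^ k) / (X ^+ (q ^ n) * X)
        = (Y ^+ (q ^ n) - Y) / Y ^+ (q ^ d).
  have := tower_op_frob k d hq Y nzX; rewrite PXY expr1n subrr.
  set c := (X in _ - X * _).
  move=> /esym/eqP; rewrite mulf_eq0 invr_eq0 (negPf (nzX' _)) orbF addrAC.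
  by rewrite subr_eq0 => /eqP->; rewrite mulfK.
have Fqw : P X w ^+ q = P X w.
  by apply/eqP; rewrite -subr_eq0 (tower_op_frob _ _ hq) // Dc Dw mul0r.
have Lw : L w.
  rewrite -(subrK (P X w * Y) w); apply: Lval; apply: rpredD; last first.
    by rewrite rpredM ?Lpred //; apply: LFq.
  by apply: Lpred; apply: LV; rewrite tower_opB // tower_opZ // PXY mulr1 subrr.
by apply: Lval; rewrite rpredB ?rpredM ?rpredV ?rpredX ?Lpred.
Qed.

End TowerStep.

Section TowerPoly.
Variables (Om : fieldType) (q k d : nat) (X : Om).
Hypotheses (hq : q%:R = 0 :> Om) (d_gt0 : (0 < d)%N) (k_gt0 : (0 < k)%N).
Hypothesis nzX : X != 0.

Definition tower_poly (t : Om) : {poly Om} :=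
  \sum_(0 <= j < d) (X ^+ (q ^ (k + j)))^-1 *: 'X^(q ^ j)
  + \sum_(0 <= j < k) (X ^+ (q ^ j))^-1 *: 'X^(q ^ (d + j)) - t%:P.

Lemma root_tower_poly t z : root (tower_poly t) z = (tower_op q k d X z == t).
Proof.
rewrite rootE /tower_poly hornerD hornerN hornerC subr_eq0 tower_opE.
rewrite hornerD !horner_sum; congr (_ + _ == _); apply: eq_bigr => j _.
  by rewrite hornerZ hornerXn mulrC.
by rewrite hornerZ hornerXn mulrC.
Qed.

Lemma coef_tower_poly (K : set Om) t i :
  subfield K -> K X -> K t -> K (tower_poly t)`_i.
Proof.
move=> hK KX Kt.
suffices /polyOverP/(_ i) : tower_poly t \is a polyOver (subfield_pred hK).
  by rewrite in_setE.
have Kp u : K u -> u \in subfield_pred hK by move=> Ku; rewrite in_setE.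
rewrite /tower_poly rpredB ?polyOverC ?Kp // rpredD // rpred_sum // => j _;
  by rewrite polyOverZ ?rpredV ?rpredX ?Kp // polyOverX.
Qed.

Lemma deriv_tower_poly t : (tower_poly t)^`() = (X ^+ (q ^ k))^-1 %:P.
Proof.
have derivXq j : (0 < j)%N -> 'X^(q ^ j)^`() = 0 :> {poly Om}.
  case: j => // j _; rewrite derivXn expnS -mulr_natr natrM.
  have -> : q%:R = (q%:R : Om)%:P by rewrite polyC_natr.
  by rewrite hq mul0r mulr0.
rewrite /tower_poly derivB derivC subr0 derivD !linear_sum /=.
rewrite big_ltn // addn0 expn0 expr1 derivZ derivX alg_polyC.
rewrite big_nat_cond big1 => [|j]; last first.
  by case/andP=> /andP[j_gt0 _] _; rewrite derivZ derivXq // scaler0.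
rewrite big1 => [|j _]; last by rewrite derivZ derivXq ?scaler0 // addn_gt0 d_gt0.
by rewrite !addr0.
Qed.

Lemma separable_tower_poly t : separable_poly (tower_poly t).
Proof.
rewrite unlock deriv_tower_poly.
rewrite -alg_polyC coprimepZr ?invr_eq0 ?expf_neq0 //.
exact: coprimep1.
Qed.

End TowerPoly.

Theorem mainTheorem2 (p e q n k : nat)
    (hp : prime p) (he : (0 < e)%N) (hq : q = (p ^ e)%N)
    (hn : (2 <= n)%N) (hk1 : (1 <= k)%N) (hkn : (k < n)%N)
    (hco : coprime k (n - k))
    (Fl : finFieldType) (hFl : #|Fl| = (q ^ n)%N)
    (Om : closedFieldType) (iota : {rmorphism Fl -> Om})
    (F : nat -> set Om) (x : nat -> Om)
    (hF : tower iota F)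
    (hOm : forall z : Om, algebraic_over (\bigcup_i F i) z)
    (hx0 : ~ algebraicOver iota (x 0%N))
    (hF0 : F 0%N = adjoin (range iota) (x 0%N))
    (hFS : forall i, F i.+1 = adjoin (F i) (x i.+1))
    (heq : forall i,
       \sum_(0 <= j < n - k) x i.+1 ^+ (q ^ j) / x i ^+ (q ^ (k + j))
       + \sum_(0 <= j < k) x i.+1 ^+ (q ^ (n - k + j)) / x i ^+ (q ^ j) = 1) :
  exists E : set Om,
    [/\ subfield E,
        finite_ext (F 0%N) E &
        forall i, galois_abelem p (composite E (F i)) (composite E (F i.+1))].
Proof.
have p_gt0 := prime_gt0 hp.
have pcharOm : p \in [pchar Om].
  apply: (rmorph_pchar iota).
  by apply: (@card_finPcharP _ _ (e * n)%N) => //; rewrite hFl hq expnM.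
have q_gt1 : (1 < q)%N by rewrite hq -{1}(expn0 p) ltn_exp2l ?prime_gt1.
have qpchar : [pchar Om].-nat q by rewrite hq pnatX pnatE ?pcharOm.
have q0 : q%:R = 0 :> Om by rewrite hq natrX (pcharf0 pcharOm) expr0n gtn_eqF.
have Dn : n = (k + (n - k))%N by rewrite subnKC // ltnW.
have d_gt0 : (0 < n - k)%N by rewrite subn_gt0.
move: (n - k)%N => d in hco heq Dn d_gt0 *.
have {}heq i : tower_op q k d (x i) (x i.+1) = 1 by rewrite tower_opE heq.
have nzx i : x i != 0.
  apply/eqP => xi0; have := heq i; rewrite xi0 tower_op0 // => /eqP.
  by rewrite eq_sym oner_eq0.
have subF i : F 0%N `<=` F i.
  by elim: i => // i IHi; apply: subset_trans IHi _; apply: hF.2.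
have Fx i : F i (x i) by case: i => [|i]; rewrite ?hF0 ?hFS; apply: mem_adjoin.
have FFq i a : a ^+ q = a -> F i a.
  move=> aq; apply: subF; rewrite hF0; apply: sub_adjoin.
  have : root (map_poly iota ('X^#|Fl| - 'X)) a.
    by rewrite rmorphB /= map_polyXn map_polyX rootE !hornerE hFl (frob_fix _ aq) subrr.
  rewrite finField_genPoly rmorph_prod /=.
  under eq_bigr do rewrite rmorphB /= map_polyX map_polyC /=.
  rewrite -(big_map iota xpredT (fun c => 'X - c%:P)) root_prod_XsubC.
  by case/mapP => c _ ->; exists c.
have hF0' : subfield (F 0%N) by rewrite hF0; apply: subfield_adjoin.
pose V0 := tower_poly q k d (x 0%N) 0.
have nzV0 : V0 != 0 by apply: separable_poly_neq0; apply: separable_tower_poly.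
have [rs Drs] := closed_field_poly_normal V0.
have rootV0 z : (z \in rs) = root V0 z.
  by rewrite Drs rootZ ?lead_coef_eq0 // root_prod_XsubC.
have [z|E [hE finE rsE]] := @finite_ext_adjoin_seq _ (F 0%N) rs hF0'.
  rewrite rootV0 => V0z; exists V0; split=> // j.
  have [F1 FB _] := (subfieldP _).1 hF0'.
  by apply: coef_tower_poly => //; rewrite -(subrr 1); apply: FB.
exists E; split=> // i.
have hEF j : subfield (composite E (F j)) by apply: subfield_gen.
have EFx j : composite E (F j) (x j) by apply: composite_subr.
have DEF j : composite E (F j.+1) = adjoin (composite E (F j)) (x j.+1).
  by rewrite hFS composite_adjoin.
have EFV j z : tower_op q k d (x j) z = 0 -> composite E (F j) z.
  elim: j z => [|j IHj] z.
    move=> /eqP; rewrite -root_tower_poly -rootV0 => /rsE Ez.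
    exact: composite_subl.
  apply: (tower_op_ker_step qpchar q_gt1 _ hco (hEF j.+1) _ (nzx j)) => //.
    by move=> a aq; apply: composite_subr; apply: FFq.
  by move=> y /IHj; rewrite DEF; apply: sub_adjoin.
rewrite DEF.
apply: (@galois_abelem_adjoin p _ _ (tower_poly q k d (x i) 1)) => //.
- move=> j; apply: (coef_tower_poly q k d j (hEF i)) => //.
  by case: ((subfieldP _).1 (hEF i)).
- exact: separable_tower_poly.
- by rewrite root_tower_poly heq.
move=> y; rewrite root_tower_poly => /eqP Py; apply: EFV.
by rewrite tower_opB // Py heq subrr.
Qed.
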